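(* For all nonzero integers $r,s,t$, $$\frac1r+\frac1{rs}+\frac1{rst}\in R^{(2)}_{\mathbb Q}.$$
   Context: For an integer sequence $\mathbf n=(n_1,n_2,\dots)$: $s^{\mathbf n}_0(t)=0$, $s^{\mathbf n}_1(t)=1$, $s^{\mathbf n}_{j+1}(t)=n_j\,t\,s^{\mathbf n}_j(t)-s^{\mathbf n}_{j-1}(t)$. For $l\ge 0$, $R^{(l)}$ is the set of $q\in\mathbb C$ such that $s^{\mathbf n}_{2m+2}(\sqrt{-q})=0$ for some integer $m\in[0,l]$ and some sequence $\mathbf n=(n_1,\dots,n_{2m+1})$ of nonzero integers (the choice of square root is irrelevant); note $0\in R^{(l)}$. $R^{(l)}_{\mathbb Q}=R^{(l)}\cap\mathbb Q$. *)

(* Defs.v *)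
From mathcomp Require Import all_boot all_order all_algebra.
From mathcomp Require Import complex.
From mathcomp Require Import boolp classical_sets reals.

Set Implicit Arguments.
Unset Strict Implicit.
Unset Printing Implicit Defensive.

Import Order.TTheory GRing.Theory Num.Theory.

Local Open Scope classical_set_scope.
Local Open Scope ring_scope.

(* [n j] is the paper's n_j for j >= 1; the entry [n 0] is never used. *)
Fixpoint spoly (A : comNzRingType) (n : nat -> int) (j : nat) (t : A) : A :=
  match j with
  | 0 => 0
  | j'.+1 =>
      match j' with
      | 0 => 1
      | j''.+1 => (n j')%:~R * t * spoly n j' t - spoly n j'' t
      end
  end.

(* [spoly n (2 * m + 2)] only involves n_1, ..., n_(2m+1), so a finite sequence
   of nonzero integers is encoded by a function on nat, constrained on
   [1, 2m+1]. [sqrtC] is a choice of square root in R[i]; the even-indexed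
   polynomials are odd in t, so this choice is irrelevant. *)
Definition Rset (R : realType) (l : nat) : set R[i] :=
  [set q | exists m : nat, (m <= l)%N /\
     exists n : nat -> int,
       (forall j : nat, (1 <= j <= 2 * m + 1)%N -> n j != 0) /\
       spoly n (2 * m + 2) (sqrtC (- q)) = 0].

Definition RsetQ (R : realType) (l : nat) : set R[i] :=
  @Rset R l `&` range (ratr : rat -> R[i]).

(* Main.v *)
Require Import Defs.
From mathcomp Require Import all_boot all_order all_algebra.
From mathcomp Require Import complex.
From mathcomp Require Import boolp classical_sets reals.
From mathcomp Require Import ring.

(** Up to nonvanishing factors, s_6(sqrt (-q)) = 0 is the continued fraction
    equation n_3 + n_1 / (1 + n_1 n_2 q) + n_5 / (1 + n_4 n_5 q) = 0. The choice
    n = (t, -rs, 1, -r, st) makes both denominators equal to 1 - rst q, so that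
    the equation becomes linear: 1 - rst q + t + st = 0. *)

Set Implicit Arguments.
Unset Strict Implicit.
Unset Printing Implicit Defensive.

Import Order.TTheory GRing.Theory Num.Theory.

Local Open Scope classical_set_scope.
Local Open Scope ring_scope.

(** Clearing the two equal denominators leaves one copy of them, the middle factor; the last factor
    is the linear equation, up to sign. *)
Lemma spoly6_factor (A : comNzRingType) (r s t : int) (x q : A) :
  x ^+ 2 = - q ->
  spoly (nth 0 [:: 0; t; - (r * s); 1; - r; s * t]) 6 x =
  x * ((r * s * t)%:~R * q - 1) *
  ((r * s * t)%:~R * q - (s * t + t + 1)%:~R).
Proof.
move=> xq; have -> : q = - x ^+ 2 by rewrite xq opprK.
by rewrite /=; ring.
Qed.

Theorem corollary4p5 (R : realType) (r s t : int) :
  r != 0 -> s != 0 -> t != 0 ->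
  @RsetQ R 2 (1 / r%:~R + 1 / (r * s)%:~R + 1 / (r * s * t)%:~R).
Proof.
move=> r0 s0 t0; split; last first.
  (* The same expression, now read in [rat], is the preimage under [ratr]. *)
  exists (1 / r%:~R + 1 / (r * s)%:~R + 1 / (r * s * t)%:~R) => //.
  by rewrite !rmorphD /= !fmorph_div /= !rmorph1 !ratr_int.
exists 2%N; split=> //.
exists (nth 0 [:: 0; t; - (r * s); 1; - r; s * t]); split.
  by do 6?case=> //=; rewrite ?oppr_eq0 ?mulf_neq0.
rewrite (spoly6_factor _ _ _ (sqrtCK _)).
(* The last factor vanishes: dividing [s * t + t + 1] by [r * s * t] termwise gives the three
   summands of q. *)
apply/eqP; rewrite mulf_eq0; apply/orP; right; rewrite subr_eq0; apply/eqP.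
by field; rewrite ?intr_eq0 ?r0 ?s0 ?t0.
Qed.
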